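(* Let $a\in\mathbb{R}\setminus\{0\}$ and let $L^a=x^2\frac{\partial^2}{\partial x^2}+x\frac{\partial}{\partial x}-a^2x^2$ on $\mathbb{R}^+=(0,\infty)$. For every $u_0\in C_0^\infty(\mathbb{R}^+)$, the Poisson problem $$L^a u(y,x)=-\frac{\partial^2}{\partial y^2}u(y,x),\quad (y,x)\in\mathbb{R}^+\times\mathbb{R}^+,\qquad u(0,x)=u_0(x),$$ has the solution given by $$u(y,x)=\int_0^\infty p_a(y,x,x')\,u_0(x')\,\frac{dx'}{x'},$$ with $$p_a(y,x,x')=\frac{|a|}{\pi}\,\frac{x x'\sin y\; K_1\!\left(|a|\sqrt{x^2+x'^2-2xx'\cos y}\right)}{\sqrt{x^2+x'^2-2xx'\cos y}},$$ where $K_1$ is the modified Bessel function of the second kind of order $1$.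
   Context: $C_0^\infty(\mathbb{R}^+)$ denotes the smooth compactly supported functions on $(0,\infty)$. The operator $L^a$ acts in the variable $x$. The condition $u(0,x)=u_0(x)$ is understood as the limit $\lim_{y\to0^+}u(y,x)=u_0(x)$.
   Formalization: The equation is asserted at all (y,x) in R^+ x R^+ except y=2kπ (k≥1) with x in supp u_0: there p_a is 0/0 at x'=x, and u, being odd and 2π-periodic in y, jumps from -u_0(x) to u_0(x), so it fails. *)

(* Defs.v *)
From HB Require Import structures.
From mathcomp Require Import all_boot all_order all_algebra.
From mathcomp Require Import all_classical all_reals all_analysis.

Set Implicit Arguments.
Unset Strict Implicit.
Unset Printing Implicit Defensive.

Import Order.TTheory GRing.Theory Num.Theory.
Import numFieldNormedType.Exports.

Local Open Scope classical_set_scope.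
Local Open Scope ring_scope.

Section defs.
Context {R : realType}.

Definition cosh (t : R) : R := (expR t + expR (- t)) / 2.

(* K_nu(z) = int_0^oo exp(- z cosh t) cosh(nu t) dt, an absolutely convergent
   integral for z > 0, the only arguments at which K_nu is meant to be used. *)
Definition besselK (nu z : R) : R :=
  \int[lebesgue_measure]_(t in `[0, +oo[) (expR (- (z * cosh t)) * cosh (nu * t)).

Definition tsupport (f : R -> R) : set R := closure [set x | f x != 0].

(* A function on ]0, +oo[ with compact support there is identified with its
   extension by 0 to R. *)
Definition test_function (f : R -> R) : Prop :=
  [/\ forall (n : nat) (x : R), derivable (derive1n n f) x 1,
      compact (tsupport f) & tsupport f `<=` `]0, +oo[].

Definition twice_derivable (f : R -> R) (x : R) : Prop :=
  (\forall t \near x, derivable f t 1) /\ derivable (derive1 f) x 1.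

Definition Lop (a : R) (f : R -> R) (x : R) : R :=
  x ^+ 2 * derive1n 2 f x + x * derive1 f x - a ^+ 2 * x ^+ 2 * f x.

(* Distance between the points of polar coordinates (x, y) and (x', 0). *)
Definition pdist (y x x' : R) : R :=
  Num.sqrt (x ^+ 2 + x' ^+ 2 - 2 * x * x' * cos y).

Definition poisson_kernel (a y x x' : R) : R :=
  `|a| / pi *
  (x * x' * sin y * besselK 1 (`|a| * pdist y x x') / pdist y x x').

Definition poisson_integrand (a : R) (u0 : R -> R) (y x x' : R) : R :=
  poisson_kernel a y x x' * u0 x' / x'.

Definition poisson_integral (a : R) (u0 : R -> R) (y x : R) : R :=
  \int[lebesgue_measure]_(x' in `]0, +oo[) poisson_integrand a u0 y x x'.

(* The points (y, x) of the quadrant at which the kernel has no vanishing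
   denominator on the support of u0. The excluded points are the (2 k pi, x)
   with k >= 1 and x in the support: there the kernel reads 0/0 at x' = x and
   the Poisson integral, which is 2 pi-periodic and odd in y, jumps from
   - u0 x to u0 x as y increases through 2 k pi, so that no equation involving
   its y-derivatives can hold where u0 x != 0. *)
Definition regular_domain (u0 : R -> R) : set (R * R) :=
  [set yx | [/\ 0 < yx.1, 0 < yx.2 &
                forall x', tsupport u0 x' -> pdist yx.1 yx.2 x' != 0]].

Definition poisson_solution (a : R) (D : set (R * R)) (u0 : R -> R)
    (u : R -> R -> R) : Prop :=
  (forall y x, D (y, x) ->
     [/\ twice_derivable (u ^~ x) y, twice_derivable (u y) x &
         Lop a (u y) x = - derive1n 2 (u ^~ x) y]) /\
  (forall x : R, 0 < x -> u y x @[y --> 0^'+] --> u0 x).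

End defs.

(* Main.v *)
(* The integrand is a multiple of x sin y K_1(|a| r) / r * u0 x', where r is the
   distance between the points of polar coordinates (x, y) and (x', 0): up to a
   constant factor it is the y-derivative of the solution K_0(|a| r) of the Helmholtz
   equation, and L^a + d^2/dy^2 is x^2 (Laplacian - a^2) in polar coordinates.  The
   equation thus amounts to Bessel's equation for K_1, read in the variable q = r^2:
   h(q) = K_1(|a| sqrt q) / sqrt q satisfies 4 q h'' + 8 h' = a^2 h.  One may
   differentiate under the integral because u0 has compact support, on which r is
   bounded below.

   As y tends to 0, put x' = x cos y + s x sin y: the integral becomes that of
   z K_1(z) u0(x cos y + s x sin y) / (pi (1 + s^2)) over the line, with
   z = |a| x sin y sqrt(1 + s^2).  From cosh = sinh + exp(-t) one gets
   exp(-z) <= z K_1(z) <= 1, and dominated convergence yields u0 x. *)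

Require Import Defs.
From mathcomp Require Import all_boot all_order all_algebra.
From mathcomp Require Import all_classical all_reals all_analysis.
From mathcomp Require Import measurable_realfun ring lra.

Set Implicit Arguments.
Unset Strict Implicit.
Unset Printing Implicit Defensive.

Import Order.TTheory GRing.Theory Num.Theory.
Import numFieldNormedType.Exports.

Local Open Scope classical_set_scope.
Local Open Scope ring_scope.

(** * Modified Bessel functions *)

Definition sinh {R : realType} (t : R) : R := (expR t - expR (- t)) / 2.

(** Expanding [(exp t - 1)^2 exp(- t) >= 0] gives [2 cosh t - 2 >= 0]. *)
Lemma cosh_ge1 (R : realType) (t : R) : 1 <= cosh t.
Proof.
have e0 := expR_gt0 t; rewrite /cosh expRN.
have e1 : expR t * (expR t)^-1 = 1 by rewrite divff ?gt_eqF.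
have := sqr_ge0 (expR t - 1); have : 0 < (expR t)^-1 by rewrite invr_gt0.
set u := expR t in e0 e1 *; set v := u^-1 in e1 * => v0 s.
have : 0 <= (u - 1)^+2 * v by rewrite mulr_ge0 // ltW.
rewrite (_ : _ * v = u * (u * v) - 2 * (u * v) + v); last by ring.
rewrite e1; lra.
Qed.

Lemma cosh_gt0 (R : realType) (t : R) : 0 < cosh t.
Proof. exact: lt_le_trans ltr01 (cosh_ge1 _). Qed.

Lemma sinh_sqr (R : realType) (t : R) : sinh t ^+ 2 = cosh t ^+ 2 - 1.
Proof.
transitivity (cosh t ^+ 2 - expR t * expR (- t)).
  by rewrite /sinh /cosh; field.
by rewrite expRN divff // gt_eqF // expR_gt0.
Qed.

Lemma cosh_expRN (R : realType) (t : R) : cosh t = sinh t + expR (- t).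
Proof. by rewrite /cosh /sinh; field. Qed.

Lemma expR_le_cosh (R : realType) (t : R) : expR t <= 2 * cosh t.
Proof. by rewrite /cosh mulrC divfK // lerDl expR_ge0. Qed.

Global Instance is_derive_cosh (R : realType) (t : R) : is_derive t 1 cosh (sinh t).
Proof.
rewrite /cosh; apply: is_derive_eq; rewrite /sinh /= /GRing.scale /=; ring.
Qed.

Global Instance is_derive_sinh (R : realType) (t : R) : is_derive t 1 sinh (cosh t).
Proof.
rewrite /sinh; apply: is_derive_eq; rewrite /cosh /= /GRing.scale /=; ring.
Qed.

Lemma continuous_cosh (R : realType) : continuous (@cosh R).
Proof. by move=> t; apply/differentiable_continuous/derivable1_diffP. Qed.

Lemma continuous_sinh (R : realType) : continuous (@sinh R).
Proof. by move=> t; apply/differentiable_continuous/derivable1_diffP. Qed.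

(** Raise [x / (n + 1) <= exp(x / (n + 1))] to the power [n + 1]. *)
Lemma expRN_exprn_le (R : realType) (n : nat) (x : R) : 0 <= x ->
  expR (- x) * x ^+ n.+1 <= n.+1%:R ^+ n.+1.
Proof.
move=> x0; rewrite mulrC expRN ler_pdivrMr ?expR_gt0 //.
rewrite [X in expR X](_ : x = n.+1%:R * (x / n.+1%:R)); last by field.
rewrite expRM_natl -exprMn lerXn2r ?nnegrE ?mulr_ge0 ?expR_ge0 //.
rewrite mulrC -ler_pdivrMr // (le_trans _ (expR_ge1Dx _)) //.
by rewrite lerDr.
Qed.

(** The common majorant of all the integrals below. The previous bound at [w cosh t] controls one
    power of [cosh t] more than is needed, and the spare factor [1 / cosh t] is at most
    [2 exp(- t)]. *)
Lemma expRN_cosh_le (R : realType) (n : nat) (w t : R) : 0 < w ->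
  expR (- (w * cosh t)) * cosh t ^+ n <= 2 * (n.+1%:R / w) ^+ n.+1 * expR (- t).
Proof.
move=> w0; have c0 := cosh_gt0 t; have := expRN_exprn_le n (ltW (mulr_gt0 w0 c0)).
rewrite exprMn => h.
have h1 : expR (- (w * cosh t)) * cosh t ^+ n.+1 <= (n.+1%:R / w) ^+ n.+1.
  by rewrite [leRHS]expr_div_n ler_pdivlMr ?exprn_gt0 // -mulrA [_ ^+ _ * w ^+ _]mulrC.
have h2 : expR (- (w * cosh t)) * cosh t ^+ n <= (n.+1%:R / w) ^+ n.+1 / cosh t.
  by rewrite ler_pdivlMr // -mulrA -exprSr.
apply: (le_trans h2); rewrite -mulrA mulrCA -[leLHS]mulr1 -mulrA ler_wpM2l //.
  by rewrite exprn_ge0 // divr_ge0 // ltW.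
rewrite mulr1 expRN ler_pdivlMr ?expR_gt0 // mulrC ler_pdivrMr //.
exact: expR_le_cosh.
Qed.

Lemma integral0y_expRN (R : realType) :
  (\int[lebesgue_measure]_(t in `[0%R, +oo[) (expR (- t) : R)%:E = 1)%E.
Proof.
rewrite (@ge0_continuous_FTC2y _ (fun t => expR (- t)) (fun t => - expR (- t)) 0 0) //.
- by rewrite oppr0 expR0 EFinN oppeK add0e.
- by apply: continuous_subspaceT => t; apply: continuous_comp;
    [exact: opp_continuous|exact: continuous_expR].
- rewrite -oppr0; apply: cvgN; exact: cvgr_expR.
- by apply: cvg_at_right_filter; apply: cvgN; apply: continuous_comp;
    [exact: opp_continuous|exact: continuous_expR].
- by move=> t _; rewrite derive1E derive_val /GRing.scale /=; ring.
Qed.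

Lemma integrable_expRN (R : realType) :
  lebesgue_measure.-integrable `[0 : R, +oo[ (fun t => (expR (- t) : R)%:E).
Proof.
apply/integrableP; split.
  apply/measurable_EFinP; apply: measurable_funTS; apply: continuous_measurable_fun => t.
  by apply: continuous_comp; [exact: opp_continuous|exact: continuous_expR].
under eq_integral => t _ do rewrite gee0_abs ?lee_fin ?expR_ge0 //.
by rewrite integral0y_expRN ltry.
Qed.

Lemma is_derive_continuous (R : realType) (f : R -> R) (x df : R) :
  is_derive x 1 f df -> {for x, continuous f}.
Proof. by move=> h; apply/differentiable_continuous/derivable1_diffP. Qed.

(** * The integrals of exp(- z cosh t) cosh^n t *)

Definition coshexp {R : realType} (n : nat) (z t : R) : R :=
  expR (- (z * cosh t)) * cosh t ^+ n.

(** Up to the sign [(-1)^n], the n-th derivative of [K_0]. The case n = 1 is [K_1], and n = 2, 3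
    give [- K_1'] and [K_1''], so Bessel's equation becomes a linear relation between three such
    integrals. *)
Definition coshexp_int {R : realType} (n : nat) (z : R) : R :=
  \int[lebesgue_measure]_(t in `[0, +oo[) coshexp n z t.

Lemma besselK1E (R : realType) (z : R) : besselK 1 z = coshexp_int 1 z.
Proof.
by apply: eq_Rintegral => t _; rewrite /coshexp mul1r expr1.
Qed.

Lemma coshexp_ge0 (R : realType) (n : nat) (z t : R) : 0 <= coshexp n z t.
Proof. by rewrite mulr_ge0 ?expR_ge0 // exprn_ge0 // ltW // cosh_gt0. Qed.

Lemma continuous_coshexp (R : realType) (n : nat) (z : R) : continuous (coshexp n z).
Proof.
move=> t; apply: cvgM.
  by apply: (is_derive_continuous (f := fun t => expR (- (z * cosh t)))).
apply: (@continuous_comp _ _ _ cosh (@GRing.exp _ ^~ n)); first exact: continuous_cosh.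
exact: exprn_continuous.
Qed.

Lemma integrable_dominated_expRN (R : realType) (f : R -> R) (C : R) :
  continuous f -> (forall t, 0 <= t -> `|f t| <= C * expR (- t)) ->
  lebesgue_measure.-integrable `[0, +oo[ (fun t => (f t)%:E).
Proof.
move=> cf fC.
have ie : lebesgue_measure.-integrable `[0, +oo[ (fun t : R => (C * expR (- t))%:E).
  by apply: (integrableZl _ C (integrable_expRN R)).
apply: (le_integrable _ _ _ ie) => //.
- by apply/measurable_EFinP; apply: measurable_funTS; exact: continuous_measurable_fun.
- move=> t; rewrite /= in_itv /= andbT => t0; rewrite lee_fin.
  exact: le_trans (fC _ t0) (ler_norm _).
Qed.

Lemma integrable_coshexp (R : realType) (n : nat) (z : R) : 0 < z ->
  lebesgue_measure.-integrable `[0, +oo[ (fun t => (coshexp n z t)%:E).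
Proof.
move=> z0; apply: integrable_dominated_expRN; first exact: continuous_coshexp.
by move=> t _; rewrite ger0_norm ?coshexp_ge0 //; exact: expRN_cosh_le.
Qed.

Lemma is_derive_coshexp (R : realType) (n : nat) (z t : R) :
  is_derive z 1 (coshexp n ^~ t) (- coshexp n.+1 z t).
Proof.
rewrite /coshexp; apply: is_derive_eq.
rewrite /GRing.scale /= exprS; ring.
Qed.

Lemma le_coshexp (R : realType) (n : nat) (w z t : R) :
  w <= z -> coshexp n z t <= coshexp n w t.
Proof.
move=> wz; rewrite ler_wpM2r ?exprn_ge0 // ?ler_expR ?lerN2 ?ler_wpM2r //;
  exact/ltW/cosh_gt0.
Qed.

(** Differentiation under the integral on the window []z / 2, 2 z[]: there the derivative of the
    integrand is largest in absolute value at the left end, and since [z / 2 > 0] its value there is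
    integrable in [t]. *)
Lemma is_derive_coshexp_int (R : realType) (n : nat) (z : R) : 0 < z ->
  is_derive z 1 (coshexp_int n) (- coshexp_int n.+1 z).
Proof.
move=> z0; have w0 : 0 < z / 2 by rewrite divr_gt0.
have Iz : `]z / 2, z * 2[%classic z by rewrite /= in_itv /=; lra.
have d1 x t : partial1of2 (coshexp n) x t = - coshexp n.+1 x t.
  by rewrite partial1of2E; exact: (@derive_val _ _ _ _ _ _ _ (is_derive_coshexp n x t)).
pose G t := coshexp n.+1 (z / 2) t.
have h1 x : `]z / 2, z * 2[%classic x ->
    lebesgue_measure.-integrable `[0, +oo[ (EFin \o coshexp n x).
  by rewrite /= in_itv /= => /andP[h _]; apply/integrable_coshexp/(lt_trans w0).
have h2 x t : `]z / 2, z * 2[%classic x -> `[0, +oo[%classic t ->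
    derivable (coshexp n ^~ t) x 1.
  by move=> _ _; exact: (@ex_derive _ _ _ _ _ _ _ (is_derive_coshexp n x t)).
have h3 x t : `]z / 2, z * 2[%classic x -> `[0, +oo[%classic t ->
    `|partial1of2 (coshexp n) x t| <= G t.
  rewrite d1 normrN ger0_norm ?coshexp_ge0 //= in_itv /= => /andP[h _] _.
  exact/le_coshexp/ltW.
have iG := integrable_coshexp n.+1 w0.
have G0 t : 0 <= G t := coshexp_ge0 _ _ _.
apply: DeriveDef.
  by apply: (derivable_under_integral _ Iz h1 h2 G0 iG h3).
rewrite -derive1E (differentiation_under_integral _ Iz h1 h2 G0 iG h3) //.
under eq_Rintegral do rewrite d1 -mulN1r.
rewrite RintegralZl //; first by rewrite mulN1r.
exact: integrable_coshexp.
Qed.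

(* [Rintegral_ge0_continuous_FTC2y], which needs a nonnegative integrand, is
   applied to [f t + C * expR (- t)]. *)
Lemma Rintegral_dominated_FTC2y (R : realType) (f F : R -> R) (C : R) :
  continuous f -> (forall t : R, is_derive t 1 F (f t)) ->
  (forall t, 0 <= t -> `|f t| <= C * expR (- t)) ->
  F t @[t --> +oo] --> 0 ->
  \int[lebesgue_measure]_(t in `[0, +oo[) f t = - F 0.
Proof.
move=> cf dF fC Fy.
have iC : lebesgue_measure.-integrable `[0, +oo[ (fun t => (C * expR (- t))%:E).
  by apply: (integrableZl _ C (integrable_expRN R)).
have ie := integrable_dominated_expRN cf fC.
have ceN : continuous (fun t : R => expR (- t)).
  by move=> t; apply/differentiable_continuous/derivable1_diffP.
have cF : continuous F.
  by move=> t; exact: is_derive_continuous.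
have h := @Rintegral_ge0_continuous_FTC2y R (fun t => f t + C * expR (- t))
  (fun t => F t - C * expR (- t)) 0 0.
have : \int[lebesgue_measure]_(t in `[0, +oo[) (f t + C * expR (- t)) = C - F 0.
  rewrite h.
  - by rewrite oppr0 expR0; ring.
  - move=> t /fC; rewrite ler_norml => /andP[+ _]; lra.
  - apply: continuous_subspaceT => t; apply: cvgD; first exact: cf.
    by apply: cvgMr; exact: ceN.
  - rewrite -[X in _ --> X](subr0 0) -[X in _ - X](mulr0 C).
    by apply: cvgB => //; apply: cvgMr; exact: cvgr_expR.
  - by move=> t _; apply: derivableB; [exact: (@ex_derive _ _ _ _ _ _ _ (dF t))|].
  - apply: cvg_at_right_filter; apply: cvgB; first exact: cF.
    by apply: cvgMr; exact: ceN.
  - move=> t _; rewrite derive1E derive_val /GRing.scale /=; ring.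
rewrite RintegralD // RintegralZl ?integrable_expRN //.
rewrite [X in _ + C * X = _](_ : _ = 1); last by rewrite /Rintegral integral0y_expRN.
by rewrite mulr1 => h1; apply: (addIr C); rewrite h1; ring.
Qed.

Lemma normr_sinh_le_cosh (R : realType) (t : R) : `|sinh t| <= cosh t.
Proof.
rewrite ler_norml /sinh /cosh; have := expR_ge0 t; have := expR_ge0 (- t).
by move=> *; apply/andP; split; lra.
Qed.

Lemma cvg_coshexp_y (R : realType) (n : nat) (z : R) : 0 < z ->
  coshexp n z t @[t --> +oo] --> 0.
Proof.
move=> z0; apply: (squeeze_cvgr (f := cst 0) (h :=
   fun t => 2 * (n.+1%:R / z) ^+ n.+1 * expR (- t))).
- by near=> t; rewrite coshexp_ge0 expRN_cosh_le.
- exact: cvg_cst.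
- rewrite -[X in _ --> X](mulr0 (2 * (n.+1%:R / z) ^+ n.+1)).
  by apply: cvgMr; exact: cvgr_expR.
Unshelve. all: by end_near. Qed.

(* Bessel's equation for K_1: the integrand is the derivative of
   [- exp(- z cosh t) (z sinh t cosh t + sinh t)], which vanishes at 0 and +oo. *)
Lemma coshexp_int_ode (R : realType) (z : R) : 0 < z ->
  z ^+ 2 * coshexp_int 3 z - z * coshexp_int 2 z - (z ^+ 2 + 1) * coshexp_int 1 z = 0.
Proof.
move=> z0.
pose F (t : R) := - (expR (- (z * cosh t)) * (z * (sinh t * cosh t) + sinh t)).
pose f t := z ^+ 2 * coshexp 3 z t - z * coshexp 2 z t - (z ^+ 2 + 1) * coshexp 1 z t.
pose B n := 2 * (n.+1%:R / z) ^+ n.+1.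
have fle t : `|f t| <=
    z ^+ 2 * coshexp 3 z t + z * coshexp 2 z t + (z ^+ 2 + 1) * coshexp 1 z t.
  have z20 := sqr_ge0 z.
  have h3 : 0 <= z ^+ 2 * coshexp 3 z t by rewrite mulr_ge0 ?coshexp_ge0.
  have h2 : 0 <= z * coshexp 2 z t by rewrite mulr_ge0 ?coshexp_ge0 // ltW.
  have h1 : 0 <= (z ^+ 2 + 1) * coshexp 1 z t by rewrite mulr_ge0 ?coshexp_ge0 // addr_ge0.
  by rewrite ler_norml /f; apply/andP; split; lra.
have ib n := integrable_coshexp n z0.
have cf : continuous f.
  move=> t; rewrite /f; apply: cvgB; [apply: cvgB|];
    by apply: cvgMr; exact: continuous_coshexp.
have dF (t : R) : is_derive t 1 F (f t).
  rewrite /F; apply: is_derive_eq; rewrite /f /coshexp /GRing.scale /=.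
  (* Eliminating [sinh^2] leaves a polynomial in [cosh t] alone, whose coefficients are those of
     Bessel's equation. *)
  have s2 := sinh_sqr t.
  ring: s2.
have Fy : F t @[t --> +oo] --> 0.
  apply: norm_cvg0; apply: (squeeze_cvgr (f := cst 0) (h :=
    fun t => z * coshexp 2 z t + coshexp 1 z t)).
  - near=> t; rewrite normr_ge0 /= /F normrN normrM ger0_norm ?expR_ge0 //.
    rewrite [leRHS](_ : _ = expR (- (z * cosh t)) * (z * cosh t ^+ 2 + cosh t)); last first.
      by rewrite /coshexp; ring.
    rewrite ler_wpM2l ?expR_ge0 //.
    rewrite (le_trans (ler_normD _ _)) // lerD ?normr_sinh_le_cosh //.
    rewrite normrM (gtr0_norm z0) ler_wpM2l ?(ltW z0) // normrM expr2 (gtr0_norm (cosh_gt0 t)).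
    by rewrite ler_wpM2r ?normr_sinh_le_cosh // ltW // cosh_gt0.
  - exact: cvg_cst.
  - rewrite -[X in _ --> X](addr0 0) -[X in X + _](mulr0 z).
    by apply: cvgD; [apply: cvgMr|]; exact: cvg_coshexp_y.
(* The constant comes from [fle], with each [coshexp n z t] replaced by its majorant
   [B n * exp(- t)]. *)
have := Rintegral_dominated_FTC2y
  (C := z ^+ 2 * B 3 + z * B 2 + (z ^+ 2 + 1) * B 1) cf dF _ Fy.
have -> : F 0 = 0 by rewrite /F /sinh oppr0 subrr; ring.
rewrite oppr0 /f => <-.
  have iZ n (c : R) : lebesgue_measure.-integrable `[0, +oo[
      (EFin \o (fun t => c * coshexp n z t)) by apply: (integrableZl _ c (ib n)).
  have iB : lebesgue_measure.-integrable `[0, +oo[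
      (EFin \o (fun t => z ^+ 2 * coshexp 3 z t - z * coshexp 2 z t)).
    by apply: (integrableB _ (iZ 3%N _) (iZ 2%N _)).
  rewrite RintegralB // RintegralB; [|by []|exact: iZ|exact: iZ].
  by rewrite !RintegralZl; [|by []|exact: ib|by []|exact: ib|by []|exact: ib].
move=> t _; apply: (le_trans (fle t)).
have hb n : coshexp n z t <= B n * expR (- t) := expRN_cosh_le n t z0.
rewrite [leRHS](_ : _ = z ^+ 2 * (B 3 * expR (- t)) + z * (B 2 * expR (- t)) +
  (z ^+ 2 + 1) * (B 1 * expR (- t))); last by ring.
by rewrite !lerD // ler_wpM2l // ?addr_ge0 ?sqr_ge0 // ltW.
Unshelve. all: by end_near. Qed.

Lemma Rintegral_sinh_expRN_cosh (R : realType) (z : R) : 0 < z ->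
  \int[lebesgue_measure]_(t in `[0, +oo[) (z * (sinh t * expR (- (z * cosh t)))) = expR (- z).
Proof.
move=> z0; pose F (t : R) := - expR (- (z * cosh t)).
have -> : expR (- z) = - F 0.
  by rewrite /F /cosh oppr0 expR0 opprK; congr (expR (- _)); field.
apply: (@Rintegral_dominated_FTC2y _ _ F (z * (2 * (2%:R / z) ^+ 2))).
- move=> t; apply: cvgMr; apply: cvgM; first exact: continuous_sinh.
  by apply: (is_derive_continuous (f := fun t => expR (- (z * cosh t)))).
- move=> t; rewrite /F; apply: is_derive_eq; rewrite /GRing.scale /=; ring.
- move=> t _; rewrite normrM (gtr0_norm z0) -mulrA ler_wpM2l ?(ltW z0) //.
  apply: le_trans (expRN_cosh_le 1 t z0).
  rewrite normrM mulrC ger0_norm ?expR_ge0 // expr1 ler_wpM2l ?expR_ge0 //.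
  exact: normr_sinh_le_cosh.
- rewrite /F -oppr0; apply: cvgN.
  rewrite (_ : (fun t => _) = coshexp 0 z); first exact: cvg_coshexp_y.
  by apply/funext => t; rewrite /coshexp expr0 mulr1.
Qed.

(** Split [cosh t = sinh t + exp(- t)]. The [sinh] part of [z K_1(z)] integrates exactly to
    [exp(- z)], which is the lower bound. As [cosh t >= 1], the rest is at most [z exp(- z)], the
    integral of [exp(- t)] being 1. *)
Lemma coshexp_int1_bounds (R : realType) (z : R) : 0 < z ->
  expR (- z) <= z * coshexp_int 1 z <= 1.
Proof.
move=> z0; rewrite -(Rintegral_sinh_expRN_cosh z0).
have i1 := integrable_coshexp 1 z0.
have iz : lebesgue_measure.-integrable `[0, +oo[ (EFin \o (fun t => z * coshexp 1 z t)).
  by apply: (integrableZl _ z i1).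
have ie : lebesgue_measure.-integrable `[0, +oo[
    (EFin \o (fun t : R => z * expR (- z) * expR (- t))).
  by apply: (integrableZl _ _ (integrable_expRN R)).
have is' : lebesgue_measure.-integrable `[0, +oo[
    (EFin \o (fun t => z * (sinh t * expR (- (z * cosh t))))).
  apply: (le_integrable _ _ _ iz) => //.
    apply/measurable_EFinP; apply: measurable_funTS; apply: continuous_measurable_fun => t.
    apply: cvgMr; apply: cvgM; first exact: continuous_sinh.
    by apply: (is_derive_continuous (f := fun t => expR (- (z * cosh t)))).
  move=> t _; rewrite lee_fin; apply: le_trans (ler_norm _).
  rewrite normrM (gtr0_norm z0) ler_wpM2l ?(ltW z0) //.
  rewrite normrM mulrC ger0_norm ?expR_ge0 // /coshexp expr1 ler_wpM2l ?expR_ge0 //.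
  exact: normr_sinh_le_cosh.
have -> : z * coshexp_int 1 z = \int[lebesgue_measure]_(t in `[0, +oo[) (z * coshexp 1 z t).
  by rewrite RintegralZl.
apply/andP; split.
  apply: le_Rintegral => // t _; rewrite ler_wpM2l ?(ltW z0) // /coshexp mulrC.
  by rewrite expr1 ler_wpM2l ?expR_ge0 // (le_trans (ler_norm _)) // normr_sinh_le_cosh.
(* The two parts add up to at most [(1 + z) exp(- z)], and [1 + z <= exp z]. *)
apply: (@le_trans _ _ ((1 + z) * expR (- z))); last first.
  by rewrite expRN ler_pdivrMr ?expR_gt0 // mul1r expR_ge1Dx.
rewrite mulrDl mul1r -{1}(Rintegral_sinh_expRN_cosh z0).
have -> : z * expR (- z) =
    \int[lebesgue_measure]_(t in `[0, +oo[) (z * expR (- z) * expR (- t)).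
  by rewrite RintegralZl ?integrable_expRN // /Rintegral integral0y_expRN mulr1.
rewrite -RintegralD //; apply: le_Rintegral => //.
  by apply: (integrableD _ is' ie).
move=> t _; rewrite -mulrA -mulrDr ler_wpM2l ?(ltW z0) //.
rewrite /coshexp expr1 cosh_expRN mulrDr [_ * sinh t]mulrC -cosh_expRN lerD2l.
rewrite ler_wpM2r ?expR_ge0 // ler_expR lerN2 ler_peMr ?cosh_ge1 //; exact: ltW.
Qed.

Lemma cvg_mul_coshexp_int1 (R : realType) :
  z * coshexp_int 1 z @[z --> (0 : R)^'+] --> (1 : R).
Proof.
apply: (squeeze_cvgr (f := fun z => expR (- z)) (h := cst 1)).
- by near=> z; apply: coshexp_int1_bounds; near: z; exact: nbhs_right_gt.
- rewrite -(expR0 R) -[X in expR X]oppr0; apply: cvg_at_right_filter.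
  by apply: (is_derive_continuous (f := fun t => expR (- t))).
- exact: cvg_cst.
Unshelve. all: by end_near. Qed.

(** [K_1(b r) / r] as a function of [q = r^2]. The squared distance is polynomial in [x], [t] and
    [cos y], so the chain rule through [q] brings in no square root of its own. *)
Definition helmholtz {R : realType} (b q : R) : R :=
  coshexp_int 1 (b * Num.sqrt q) / Num.sqrt q.

Definition helmholtz1 {R : realType} (b q : R) : R :=
  - (b * coshexp_int 2 (b * Num.sqrt q) / (2 * q) +
     coshexp_int 1 (b * Num.sqrt q) / (2 * q * Num.sqrt q)).

(* The second derivative of [helmholtz b], simplified by Bessel's equation. *)
Definition helmholtz2 {R : realType} (b q : R) : R :=
  (b ^+ 2 * helmholtz b q - 8 * helmholtz1 b q) / (4 * q).

Lemma is_derive_coshexp_int_sqrt (R : realType) (n : nat) (b q : R) : 0 < b -> 0 < q ->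
  is_derive q 1 (fun q => coshexp_int n (b * Num.sqrt q))
    (- (b * coshexp_int n.+1 (b * Num.sqrt q) / (2 * Num.sqrt q))).
Proof.
move=> b0 q0; have s0 : 0 < Num.sqrt q by rewrite sqrtr_gt0.
have ds := is_derive1_sqrt q0.
have dJ := is_derive_coshexp_int n (mulr_gt0 b0 s0).
have := @is_derive1_comp _ (coshexp_int n) (fun q => b * Num.sqrt q) q _ _ dJ _.
move=> /(_ _ _)/is_derive_eq; apply.
rewrite /GRing.scale /=; field; exact: lt0r_neq0.
Qed.

Lemma is_derive_helmholtz (R : realType) (b q : R) : 0 < b -> 0 < q ->
  is_derive q 1 (helmholtz b) (helmholtz1 b q).
Proof.
move=> b0 q0; have s0 : 0 < Num.sqrt q by rewrite sqrtr_gt0.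
have ds := is_derive1_sqrt q0; have sn0 := lt0r_neq0 s0.
have dJ := is_derive_coshexp_int_sqrt 1 b0 q0.
rewrite /helmholtz; apply: is_derive_eq; rewrite /GRing.scale /= /helmholtz1.
have qE : q = Num.sqrt q ^+ 2 by rewrite sqr_sqrtr ?ltW.
move: (coshexp_int _ _) (coshexp_int _ _) => j1 j2.
by set s := Num.sqrt q in sn0 qE *; rewrite [in RHS]qE; field.
Qed.

Lemma is_derive_helmholtz1 (R : realType) (b q : R) : 0 < b -> 0 < q ->
  is_derive q 1 (helmholtz1 b) (helmholtz2 b q).
Proof.
move=> b0 q0; have s0 : 0 < Num.sqrt q by rewrite sqrtr_gt0.
have ds := is_derive1_sqrt q0; have sn0 := lt0r_neq0 s0; have bn0 := lt0r_neq0 b0.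
have qn0 : 2 * q != 0 by rewrite lt0r_neq0 // mulr_gt0.
have qsn0 : 2 * q * Num.sqrt q != 0 by rewrite mulf_neq0.
have dJ1 := is_derive_coshexp_int_sqrt 1 b0 q0.
have dJ2 := is_derive_coshexp_int_sqrt 2 b0 q0.
rewrite /helmholtz1; apply: is_derive_eq; rewrite /GRing.scale /=.
rewrite /helmholtz2 /helmholtz /helmholtz1.
have qE : q = Num.sqrt q ^+ 2 by rewrite sqr_sqrtr ?ltW.
(* Differentiating twice produces the third integral. Bessel's equation at [z = b sqrt q] expresses
   it through the first two, after which both sides are rational in [b] and [sqrt q] and linear in
   [j1], [j2]. *)
have := coshexp_int_ode (mulr_gt0 b0 s0).
set s := Num.sqrt q in sn0 qE *; set z := b * s.
move: (coshexp_int 1 z) (coshexp_int 2 z) (coshexp_int 3 z) => j1 j2 j3 ode.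
have -> : j3 = (z * j2 + (z ^+ 2 + 1) * j1) / z ^+ 2.
  have zn0 : z != 0 by rewrite mulf_neq0.
  apply: (canRL (mulfK _)); first by rewrite expf_neq0.
  by rewrite -[RHS]add0r -ode; ring.
by rewrite /z qE; field; rewrite sn0 bn0.
Qed.

(** * Differentiation under the integral sign *)

Lemma continuous_pairr (R : realType) (s : R) : continuous (fun t : R => (s, t)).
Proof.
move=> t; apply: (cvg_pair (G := nbhs s) (H := nbhs t)); first exact: cvg_cst.
exact: cvg_id.
Qed.

(** Around each [(s, t)] continuity gives the local bound [|h s t| + 1]. To make it uniform over
    [K], the bound [M] is treated as a second parameter tending to +oo along with [s'] tending to
    [s], and compactness is applied to the product filter. *)
Lemma near_compact_bounded (R : realType) (K : set R) (h : R -> R -> R) (s : R) :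
  compact K ->
  (forall t, K t -> {for (s, t), continuous (fun p : R * R => h p.1 p.2)}) ->
  exists M : R, \forall s' \near s, forall t, K t -> `|h s' t| <= M.
Proof.
move=> cK ch.
have cov : near_covering K by apply/compact_near_coveringP.
have := cov _ (filter_prod (nbhs s) (pinfty_nbhs R)) (fun i t => `|h i.1 t| <= i.2) _.
case => [t Kt|[A B] /= [nA nB] AB].
  have /cvgrPdist_lt/(_ _ ltr01)[[A B] /= [nA nB] AB] := ch t Kt.
  exists (B, A `*` [set M | `|h s t| + 1 <= M]) => /=.
    split=> //; exists (A, [set M | `|h s t| + 1 <= M]) => //=.
    by split=> //=; exact: nbhs_pinfty_ge.
  move=> [t' [s' M]] /= [Bt' [As' hM]].
  have := AB (s', t') (conj As' Bt'); rewrite /= => hd.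
  have := lerB_dist (h s' t') (h s t); rewrite distrC; lra.
have [M BM] := filter_ex nB.
exists M; apply: filterS nA => s' As' t Kt.
exact: (AB (s', M) (conj As' BM) t Kt).
Qed.

(** By joint continuity of [h'] and compactness of [K], [h'] is bounded by a constant for parameters
    near [s]; a constant is integrable on [K], so it serves as the dominating function. *)
Lemma is_derive_integral_compact (R : realType) (K U : set R) (h h' : R -> R -> R) :
  compact K -> open U ->
  (forall s t, U s -> K t -> is_derive s 1 (h ^~ t) (h' s t)) ->
  (forall s t, U s -> K t -> {for (s, t), continuous (fun p : R * R => h p.1 p.2)}) ->
  (forall s t, U s -> K t -> {for (s, t), continuous (fun p : R * R => h' p.1 p.2)}) ->
  forall s, U s ->
  is_derive s 1 (fun s => \int[lebesgue_measure]_(t in K) h s t)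
    (\int[lebesgue_measure]_(t in K) h' s t).
Proof.
move=> cK oU dh ch ch' s Us.
have [M bM] := near_compact_bounded cK (fun t => ch' s t Us).
have nU : \forall s' \near s, U s' by exact: open_nbhs_nbhs.
have [e /= e0 he] : \forall s' \near s, U s' /\ (forall t, K t -> `|h' s' t| <= M).
  by near=> s'; split; near: s'.
have Is : `]s - e, s + e[%classic s by rewrite /= in_itv /= ltrBlDr ltrDl e0.
have IU x : `]s - e, s + e[%classic x -> U x /\ (forall t, K t -> `|h' x t| <= M).
  rewrite /= in_itv /= => /andP[h1 h2]; apply: he.
  by rewrite /= ltr_norml; apply/andP; split; lra.
have ih x : U x -> lebesgue_measure.-integrable K (EFin \o h x).
  move=> Ux; apply: continuous_compact_integrable => //.
  apply: continuous_in_subspaceT => t; rewrite inE => Kt.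
  apply: (cvg_comp (fun t => (x, t)) (fun p : R * R => h p.1 p.2) _ (ch x t Ux Kt)).
  exact: continuous_pairr.
have mK := compact_measurable cK.
have d1 x t : U x -> K t -> partial1of2 h x t = h' x t.
  by move=> Ux Kt; rewrite partial1of2E; exact: (@derive_val _ _ _ _ _ _ _ (dh x t Ux Kt)).
have h1 x : `]s - e, s + e[%classic x -> lebesgue_measure.-integrable K (EFin \o h x).
  by move=> /IU[Ux _]; exact: ih.
have h2 x t : `]s - e, s + e[%classic x -> K t -> derivable (h ^~ t) x 1.
  by move=> /IU[Ux _] Kt; exact: (@ex_derive _ _ _ _ _ _ _ (dh x t Ux Kt)).
(* The absolute value makes the majorant nonnegative even when [K] is empty, where [M] may be
   negative. *)
pose G (t : R) := `|M|.
have h3 x t : `]s - e, s + e[%classic x -> K t -> `|partial1of2 h x t| <= G t.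
  by move=> /IU[Ux hM] Kt; rewrite d1 // (le_trans (hM t Kt)) // ler_norm.
have iG : lebesgue_measure.-integrable K (EFin \o G).
  by apply: continuous_compact_integrable => // t; exact: cvg_cst.
have G0 t : 0 <= G t by exact: normr_ge0.
apply: DeriveDef.
  by apply: (derivable_under_integral _ Is h1 h2 G0 iG h3).
rewrite -derive1E (differentiation_under_integral _ Is h1 h2 G0 iG h3) //.
by apply: eq_Rintegral => t; rewrite inE => Kt; exact: d1.
Unshelve. all: by end_near. Qed.

(** * The Poisson kernel *)

Definition sqdist {R : realType} (y x t : R) : R :=
  x ^+ 2 + t ^+ 2 - 2 * x * t * cos y.

Section kernel.
Context {R : realType}.
Implicit Types b y x t : R.

(** The Poisson kernel without [|a| / pi] and without its factor [x']: the latter cancels against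
    the measure [dx' / x'], and the constant is later attached to [u0]. *)
Definition pkern b y x t : R := x * sin y * helmholtz b (sqdist y x t).

Definition pkern_y b y x t : R :=
  x * cos y * helmholtz b (sqdist y x t) +
  x * sin y * (2 * x * t * sin y * helmholtz1 b (sqdist y x t)).

Definition pkern_yy b y x t : R :=
  - (x * sin y * helmholtz b (sqdist y x t)) +
  2 * (x * cos y) * (2 * x * t * sin y) * helmholtz1 b (sqdist y x t) +
  x * sin y * (2 * x * t * cos y * helmholtz1 b (sqdist y x t) +
               (2 * x * t * sin y) ^+ 2 * helmholtz2 b (sqdist y x t)).

Definition pkern_x b y x t : R :=
  sin y * helmholtz b (sqdist y x t) +
  x * sin y * ((2 * x - 2 * t * cos y) * helmholtz1 b (sqdist y x t)).

Definition pkern_xx b y x t : R :=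
  2 * sin y * ((2 * x - 2 * t * cos y) * helmholtz1 b (sqdist y x t)) +
  x * sin y * (2 * helmholtz1 b (sqdist y x t) +
               (2 * x - 2 * t * cos y) ^+ 2 * helmholtz2 b (sqdist y x t)).

(** Once [h''] is tied to [h] and [h'] by the equation in [q], the claim is a polynomial identity
    modulo [sin^2 + cos^2 = 1]. *)
Lemma pkern_pde b y x t : 0 < sqdist y x t ->
  x ^+ 2 * pkern_xx b y x t + x * pkern_x b y x t - b ^+ 2 * x ^+ 2 * pkern b y x t =
  - pkern_yy b y x t.
Proof.
move=> q0; have qn0 := lt0r_neq0 q0.
have s2 : sin y ^+ 2 = 1 - cos y ^+ 2 by rewrite sin2cos2.
rewrite /pkern /pkern_x /pkern_xx /pkern_yy /helmholtz2.
set q := sqdist y x t in q0 qn0 *.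
move: (helmholtz b q) (helmholtz1 b q) => h h1.
set k := (b ^+ 2 * h - 8 * h1) / (4 * q).
(* The parameter [b] enters only through [b^2 h]. Substituting for it makes [h'] and [h'']
   independent unknowns. *)
have hk : b ^+ 2 * h = 4 * q * k + 8 * h1 by rewrite /k; field.
have qE : q = x ^+ 2 + t ^+ 2 - 2 * x * t * cos y by [].
have -> : b ^+ 2 * x ^+ 2 * (x * sin y * h) = x ^+ 3 * sin y * (b ^+ 2 * h) by ring.
rewrite hk qE; clear hk; clearbody k.
apply/eqP; rewrite -subr_eq0; apply/eqP.
transitivity (4 * x ^+ 3 * sin y * t ^+ 2 * k * (sin y ^+ 2 - (1 - cos y ^+ 2))).
  ring.
by rewrite s2 subrr mulr0.
Qed.

Lemma is_derive_sqdist_y y x t :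
  is_derive y 1 (fun y => sqdist y x t) (2 * x * t * sin y).
Proof. by rewrite /sqdist; apply: is_derive_eq; rewrite /GRing.scale /=; ring. Qed.

Lemma is_derive_sqdist_x y x t :
  is_derive x 1 (fun x => sqdist y x t) (2 * x - 2 * t * cos y).
Proof. by rewrite /sqdist; apply: is_derive_eq; rewrite /GRing.scale /=; ring. Qed.

Variables b y x t : R.
Hypotheses (b0 : 0 < b) (q0 : 0 < sqdist y x t).

Lemma is_derive_pkern_y : is_derive y 1 (fun y => pkern b y x t) (pkern_y b y x t).
Proof.
have dq := is_derive_sqdist_y y x t.
have dh := @is_derive1_comp R (helmholtz b) (fun y => sqdist y x t) y _ _
  (is_derive_helmholtz b0 q0) dq.
rewrite /pkern; apply: is_derive_eq; rewrite /GRing.scale /= /pkern_y; ring.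
Qed.

Lemma is_derive_pkern_yy : is_derive y 1 (fun y => pkern_y b y x t) (pkern_yy b y x t).
Proof.
have dq := is_derive_sqdist_y y x t.
have dh := @is_derive1_comp R (helmholtz b) (fun y => sqdist y x t) y _ _
  (is_derive_helmholtz b0 q0) dq.
have dh1 := @is_derive1_comp R (helmholtz1 b) (fun y => sqdist y x t) y _ _
  (is_derive_helmholtz1 b0 q0) dq.
rewrite /pkern_y; apply: is_derive_eq; rewrite /GRing.scale /= /pkern_yy; ring.
Qed.

Lemma is_derive_pkern_x : is_derive x 1 (fun x => pkern b y x t) (pkern_x b y x t).
Proof.
have dq := is_derive_sqdist_x y x t.
have dh := @is_derive1_comp R (helmholtz b) (fun x => sqdist y x t) x _ _
  (is_derive_helmholtz b0 q0) dq.
rewrite /pkern; apply: is_derive_eq; rewrite /GRing.scale /= /pkern_x; ring.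
Qed.

Lemma is_derive_pkern_xx : is_derive x 1 (fun x => pkern_x b y x t) (pkern_xx b y x t).
Proof.
have dq := is_derive_sqdist_x y x t.
have dh := @is_derive1_comp R (helmholtz b) (fun x => sqdist y x t) x _ _
  (is_derive_helmholtz b0 q0) dq.
have dh1 := @is_derive1_comp R (helmholtz1 b) (fun x => sqdist y x t) x _ _
  (is_derive_helmholtz1 b0 q0) dq.
rewrite /pkern_x; apply: is_derive_eq; rewrite /GRing.scale /= /pkern_xx; ring.
Qed.

End kernel.

(** * Continuity of the kernel and of its derivatives *)

Section continuity.
Context {R : realType} {T : topologicalType}.
Variables (b : R) (Y X S : T -> R) (p : T).
Hypotheses (cY : {for p, continuous Y}) (cX : {for p, continuous X})
  (cS : {for p, continuous S}).

Let comp (f : T -> R) (g : R -> R) : {for p, continuous f} ->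
  {for f p, continuous g} -> {for p, continuous (fun i => g (f i))}.
Proof. by move=> cf cg; exact: (continuous_comp cf cg). Qed.

Let ccos : {for p, continuous (fun i => cos (Y i))}.
Proof. exact: (comp cY (@continuous_cos _ _)). Qed.

Let csin : {for p, continuous (fun i => sin (Y i))}.
Proof. exact: (comp cY (@continuous_sin _ _)). Qed.

Let csqr (f : T -> R) : {for p, continuous f} -> {for p, continuous (fun i => f i ^+ 2)}.
Proof.
by move=> cf; exact: (comp (g := (@GRing.exp R ^~ 2)) cf (@exprn_continuous _ _ _)).
Qed.

Let cc (c : R) : {for p, continuous (fun i : T => c)}.
Proof. exact: cvg_cst. Qed.

Let cD (f g : T -> R) : {for p, continuous f} -> {for p, continuous g} ->
  {for p, continuous (fun i => f i + g i)}.
Proof. exact: cvgD. Qed.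

Let cN (f : T -> R) : {for p, continuous f} -> {for p, continuous (fun i => - f i)}.
Proof. exact: cvgN. Qed.

Let cM (f g : T -> R) : {for p, continuous f} -> {for p, continuous g} ->
  {for p, continuous (fun i => f i * g i)}.
Proof. exact: cvgM. Qed.

(* Goal-directed: trying the lemmas one after the other would make unification
   unfold [helmholtz] and the trigonometric functions. *)
Ltac cont :=
  match goal with |- prop_for _ (inPhantom (continuous ?F)) =>
    lazymatch F with
    | (fun i => @?f i + @?g i) => refine (@cD f g _ _); cont
    | (fun i => @?f i * @?g i) => refine (@cM f g _ _); cont
    | (fun i => - @?f i) => refine (@cN f _); cont
    | (fun i => @?f i ^+ 2) => refine (@csqr f _); cont
    | (fun i => cos _) => exact ccos
    | (fun i => sin _) => exact csin
    | (fun i => X i) => exact cX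
    | (fun i => S i) => exact cS
    | X => exact cX
    | S => exact cS
    | (fun i => helmholtz _ _) => assumption
    | (fun i => helmholtz1 _ _) => assumption
    | (fun i => helmholtz2 _ _) => assumption
    | (fun i => ?c) => exact (@cc c)
    end
  end.

(** The point [(y, x, t)] moves along three arbitrary maps from a topological space, so that the
    same statements cover joint continuity in [(y, t)], in [(x, t)], and continuity in [t] alone. *)
Lemma continuous_sqdist : {for p, continuous (fun i => sqdist (Y i) (X i) (S i))}.
Proof. rewrite /sqdist; cont. Qed.

Hypotheses (b0 : 0 < b) (q0 : 0 < sqdist (Y p) (X p) (S p)).

Let ch : {for p, continuous (fun i => helmholtz b (sqdist (Y i) (X i) (S i)))}.
Proof.
apply: (comp continuous_sqdist).
exact: is_derive_continuous (is_derive_helmholtz b0 q0).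
Qed.

Let ch1 : {for p, continuous (fun i => helmholtz1 b (sqdist (Y i) (X i) (S i)))}.
Proof.
apply: (comp continuous_sqdist).
exact: is_derive_continuous (is_derive_helmholtz1 b0 q0).
Qed.

(** The form of the second derivative simplified by Bessel's equation involves only [h], [h'] and
    [q], so its continuity requires no third derivative. *)
Let ch2 : {for p, continuous (fun i => helmholtz2 b (sqdist (Y i) (X i) (S i)))}.
Proof.
rewrite /helmholtz2; apply: cvgM.
  by apply: cvgB; apply: cvgM; [exact: cc|exact: ch|exact: cc|exact: ch1].
apply: cvgV; first by rewrite mulf_neq0 ?lt0r_neq0.
by apply: cvgM; [exact: cc|exact: continuous_sqdist].
Qed.

Lemma continuous_pkern : {for p, continuous (fun i => pkern b (Y i) (X i) (S i))}.
Proof. rewrite /pkern; cont. Qed.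

Lemma continuous_pkern_y : {for p, continuous (fun i => pkern_y b (Y i) (X i) (S i))}.
Proof. rewrite /pkern_y; cont. Qed.

Lemma continuous_pkern_yy : {for p, continuous (fun i => pkern_yy b (Y i) (X i) (S i))}.
Proof. rewrite /pkern_yy; cont. Qed.

Lemma continuous_pkern_x : {for p, continuous (fun i => pkern_x b (Y i) (X i) (S i))}.
Proof. rewrite /pkern_x; cont. Qed.

Lemma continuous_pkern_xx : {for p, continuous (fun i => pkern_xx b (Y i) (X i) (S i))}.
Proof. rewrite /pkern_xx; cont. Qed.

End continuity.

(** The tube lemma: near [(s, t)] the function stays above half of its positive value there, and
    compactness makes the neighbourhood of [s] uniform in [t]. *)
Lemma open_forall_compact_gt0 (R : realType) (K : set R) (q : R -> R -> R) :
  compact K -> continuous (fun p : R * R => q p.1 p.2) ->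
  open [set s | forall t, K t -> 0 < q s t].
Proof.
move=> cK cq; rewrite openE => s /= qs.
have cov : near_covering K by apply/compact_near_coveringP.
have := cov _ (nbhs s) (fun s t => 0 < q s t) _.
case => [t Kt|e e0 he]; last by exists e.
have /(_ _) := cvgr_gt _ (cq (s, t)) (q s t / 2).
case; first by rewrite ltr_pdivrMr // ltr_pMr ?qs // ltr1n.
move=> [A B] /= [nA nB] AB; exists (B, A) => //= -[t' s'] [/= Bt' As'].
have := AB (s', t') (conj As' Bt'); apply: lt_trans.
by rewrite divr_gt0 // qs.
Qed.

(** * The equation *)

Lemma continuous_test_function (R : realType) (f : R -> R) :
  test_function f -> continuous f.
Proof.
case=> /(_ 0%N) df _ _ t; apply/differentiable_continuous/derivable1_diffP; exact: df.
Qed.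

Lemma is_derive_mulr (R : realType) (f : R -> R) (x df c : R) :
  is_derive x 1 f df -> is_derive x 1 (fun x => f x * c) (df * c).
Proof.
by move=> h; apply: is_derive_eq; rewrite /GRing.scale /=; ring.
Qed.

Lemma tsupport_out (R : realType) (f : R -> R) (t : R) : ~ tsupport f t -> f t = 0.
Proof.
by move=> nt; apply/eqP; apply: contrapT => /negP h; apply: nt; exact: subset_closure.
Qed.

(** The first derivative of [f] is known to be [g] only on [U]; as [U] is open, the two agree near
    [x], which is enough to carry the derivative of [g] over. *)
Lemma twice_derivable_of_is_derive (R : realType) (f g : R -> R) (U : set R) (x l : R) :
  open U -> U x -> (forall s, U s -> is_derive s 1 f (g s)) -> is_derive x 1 g l ->
  twice_derivable f x /\ derive1n 2 f x = l.
Proof.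
move=> oU Ux0 df dg.
have nU : \forall s \near x, U s by exact: open_nbhs_nbhs.
have eg : \forall s \near x, g s = derive1 f s.
  apply: filterS nU => s /df h.
  by rewrite derive1E; symmetry; exact: (@derive_val _ _ _ _ _ _ _ h).
have dg' : is_derive x 1 (derive1 f) l := near_eq_is_derive eg dg.
split; last by rewrite /= derive1E; exact: (@derive_val _ _ _ _ _ _ _ dg').
split; last exact: (@ex_derive _ _ _ _ _ _ _ dg').
by apply: filterS nU => s /df h; exact: (@ex_derive _ _ _ _ _ _ _ h).
Qed.

Section pde.
Context {R : realType} (b : R) (v : R -> R) (K : set R).
Hypotheses (b0 : 0 < b) (cv : continuous v) (cK : compact K).

(** The kernel is a parameter, so that the Poisson integral and its four partial derivatives are
    instances of one integral. *)
Definition kint (k : R -> R -> R -> R -> R) (y x : R) : R :=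
  \int[lebesgue_measure]_(t in K) (k b y x t * v t).

(** The parameters for which no point of [K] makes the distance vanish; their openness is what
    allows differentiation under the integral. *)
Let Uy x := [set y | forall t, K t -> 0 < sqdist y x t].
Let Ux y := [set x | forall t, K t -> 0 < sqdist y x t].

Let cfst (T U : topologicalType) (p : T * U) : {for p, continuous fst}.
Proof. exact: cvg_fst. Qed.
Let csnd (T U : topologicalType) (p : T * U) : {for p, continuous snd}.
Proof. exact: cvg_snd. Qed.
Let ccst (T : topologicalType) (p : T) (c : R) : {for p, continuous (fun _ : T => c)}.
Proof. exact: cvg_cst. Qed.

Let cvsnd (p : R * R) : {for p, continuous (fun p => v p.2)}.
Proof. by apply: (continuous_comp (@csnd _ _ p)); exact: cv. Qed.

Lemma open_Uy x : open (Uy x).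
Proof.
apply: open_forall_compact_gt0 => // p.
exact: (continuous_sqdist (@cfst _ _ p) (@ccst _ p x) (@csnd _ _ p)).
Qed.

Lemma open_Ux y : open (Ux y).
Proof.
apply: open_forall_compact_gt0 => // p.
exact: (continuous_sqdist (@ccst _ p y) (@cfst _ _ p) (@csnd _ _ p)).
Qed.

Lemma is_derive_kint_y x y : Uy x y ->
  is_derive y 1 (fun y => kint pkern y x) (kint pkern_y y x).
Proof.
apply: (is_derive_integral_compact (h := fun y t => pkern b y x t * v t)
  (h' := fun y t => pkern_y b y x t * v t) cK (@open_Uy x)).
- by move=> s t Us Kt; apply: is_derive_mulr; exact: is_derive_pkern_y b0 (Us t Kt).
- move=> s t Us Kt; apply: cvgM; last exact: cvsnd.
  exact: (continuous_pkern (@cfst _ _ (s, t)) (@ccst _ _ x) (@csnd _ _ _) b0 (Us t Kt)).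
- move=> s t Us Kt; apply: cvgM; last exact: cvsnd.
  exact: (continuous_pkern_y (@cfst _ _ (s, t)) (@ccst _ _ x) (@csnd _ _ _) b0 (Us t Kt)).
Qed.

Lemma is_derive_kint_yy x y : Uy x y ->
  is_derive y 1 (fun y => kint pkern_y y x) (kint pkern_yy y x).
Proof.
apply: (is_derive_integral_compact (h := fun y t => pkern_y b y x t * v t)
  (h' := fun y t => pkern_yy b y x t * v t) cK (@open_Uy x)).
- by move=> s t Us Kt; apply: is_derive_mulr; exact: is_derive_pkern_yy b0 (Us t Kt).
- move=> s t Us Kt; apply: cvgM; last exact: cvsnd.
  exact: (continuous_pkern_y (@cfst _ _ (s, t)) (@ccst _ _ x) (@csnd _ _ _) b0 (Us t Kt)).
- move=> s t Us Kt; apply: cvgM; last exact: cvsnd.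
  exact: (continuous_pkern_yy (@cfst _ _ (s, t)) (@ccst _ _ x) (@csnd _ _ _) b0 (Us t Kt)).
Qed.

Lemma is_derive_kint_x y x : Ux y x ->
  is_derive x 1 (kint pkern y) (kint pkern_x y x).
Proof.
apply: (is_derive_integral_compact (h := fun x t => pkern b y x t * v t)
  (h' := fun x t => pkern_x b y x t * v t) cK (@open_Ux y)).
- by move=> s t Us Kt; apply: is_derive_mulr; exact: is_derive_pkern_x b0 (Us t Kt).
- move=> s t Us Kt; apply: cvgM; last exact: cvsnd.
  exact: (continuous_pkern (@ccst _ _ y) (@cfst _ _ (s, t)) (@csnd _ _ _) b0 (Us t Kt)).
- move=> s t Us Kt; apply: cvgM; last exact: cvsnd.
  exact: (continuous_pkern_x (@ccst _ _ y) (@cfst _ _ (s, t)) (@csnd _ _ _) b0 (Us t Kt)).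
Qed.

Lemma is_derive_kint_xx y x : Ux y x ->
  is_derive x 1 (kint pkern_x y) (kint pkern_xx y x).
Proof.
apply: (is_derive_integral_compact (h := fun x t => pkern_x b y x t * v t)
  (h' := fun x t => pkern_xx b y x t * v t) cK (@open_Ux y)).
- by move=> s t Us Kt; apply: is_derive_mulr; exact: is_derive_pkern_xx b0 (Us t Kt).
- move=> s t Us Kt; apply: cvgM; last exact: cvsnd.
  exact: (continuous_pkern_x (@ccst _ _ y) (@cfst _ _ (s, t)) (@csnd _ _ _) b0 (Us t Kt)).
- move=> s t Us Kt; apply: cvgM; last exact: cvsnd.
  exact: (continuous_pkern_xx (@ccst _ _ y) (@cfst _ _ (s, t)) (@csnd _ _ _) b0 (Us t Kt)).
Qed.

Let ikint (k : R -> R -> R -> R -> R) y x :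
  (forall t, K t -> {for t, continuous (k b y x)}) ->
  lebesgue_measure.-integrable K (EFin \o (fun t => k b y x t * v t)).
Proof.
move=> ck; apply: continuous_compact_integrable => //.
apply: continuous_in_subspaceT => t; rewrite inE => Kt.
by apply: cvgM; [exact: ck|exact: cv].
Qed.

(** The equation of the kernel holds for each [t] in [K]. Every term is continuous on the compact
    [K], hence integrable, so it may be integrated term by term. *)
Lemma kint_pde y x : Ux y x ->
  x ^+ 2 * kint pkern_xx y x + x * kint pkern_x y x - b ^+ 2 * x ^+ 2 * kint pkern y x =
  - kint pkern_yy y x.
Proof.
move=> q0; have mK := compact_measurable cK.
have cid (t : R) : {for t, continuous id} by exact: cvg_id.
have i0 : lebesgue_measure.-integrable K (EFin \o (fun t => pkern b y x t * v t)).
  apply: ikint => t Kt.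
  exact: (continuous_pkern (@ccst _ t y) (@ccst _ _ x) (cid t) b0 (q0 t Kt)).
have i1 : lebesgue_measure.-integrable K (EFin \o (fun t => pkern_x b y x t * v t)).
  apply: ikint => t Kt.
  exact: (continuous_pkern_x (@ccst _ t y) (@ccst _ _ x) (cid t) b0 (q0 t Kt)).
have i2 : lebesgue_measure.-integrable K (EFin \o (fun t => pkern_xx b y x t * v t)).
  apply: ikint => t Kt.
  exact: (continuous_pkern_xx (@ccst _ t y) (@ccst _ _ x) (cid t) b0 (q0 t Kt)).
have iZ (f : R -> R) (c : R) : lebesgue_measure.-integrable K (EFin \o f) ->
    lebesgue_measure.-integrable K (EFin \o (fun t => c * f t)).
  by move=> h; apply: (integrableZl _ c h).
have i3 : lebesgue_measure.-integrable K
    (EFin \o (fun t => x ^+ 2 * (pkern_xx b y x t * v t) + x * (pkern_x b y x t * v t))).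
  by apply: (integrableD _ (iZ _ _ i2) (iZ _ _ i1)).
have iy : lebesgue_measure.-integrable K (EFin \o (fun t => pkern_yy b y x t * v t)).
  apply: ikint => t Kt.
  exact: (continuous_pkern_yy (@ccst _ t y) (@ccst _ _ x) (cid t) b0 (q0 t Kt)).
rewrite /kint -[RHS]mulN1r -!RintegralZl //.
rewrite -RintegralD //; [|exact: iZ|exact: iZ].
rewrite -RintegralB //; last exact: iZ.
apply: eq_Rintegral => t; rewrite inE => Kt.
rewrite [RHS]mulN1r -[RHS]mulNr -(pkern_pde b (q0 t Kt)); ring.
Qed.

End pde.

(** * Reduction of the Poisson integral to the support of u0 *)

Lemma pdistE (R : realType) (y x t : R) : pdist y x t = Num.sqrt (sqdist y x t).
Proof. by []. Qed.

(** Cartesian form of the distance. It shows positivity for every real [t] as soon as [x sin y] is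
    nonzero, and suggests the substitution [t = x cos y + s x sin y]. *)
Lemma sqdistE (R : realType) (y x t : R) :
  sqdist y x t = (t - x * cos y) ^+ 2 + (x * sin y) ^+ 2.
Proof. rewrite /sqdist [(x * _) ^+ 2]exprMn sin2cos2; ring. Qed.

Lemma poisson_integrandE (R : realType) (a : R) (u0 : R -> R) (y x t : R) : 0 < t ->
  poisson_integrand a u0 y x t = pkern `|a| y x t * (`|a| / pi * u0 t).
Proof.
move=> t0; rewrite /poisson_integrand /poisson_kernel /pkern /helmholtz besselK1E pdistE.
move: (coshexp_int 1 _) => j.
transitivity (x * sin y * (j / Num.sqrt (sqdist y x t)) * (`|a| / pi * u0 t) * (t / t)).
  by ring.
by rewrite divff ?mulr1 // gt_eqF.
Qed.

Section solution.
Context {R : realType} (a : R) (u0 : R -> R).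
Hypotheses (ha : a != 0) (hu0 : test_function u0).

Let v t := `|a| / pi * u0 t.
Let K := tsupport u0.

Let a0 : 0 < `|a|. Proof. by rewrite normr_gt0. Qed.
Let cK : compact K. Proof. by case: hu0. Qed.
Let K0 t : K t -> 0 < t.
Proof. by case: hu0 => _ _ h /h; rewrite /= in_itv /= andbT. Qed.
Let cv : continuous v.
Proof. by move=> t; apply: cvgMr; exact: continuous_test_function. Qed.

(** [u0] vanishes off [K], and [K] lies in the open half-line, where the factors [t] cancel. The
    half-line integral thus becomes one over a compact set. *)
Let restrictE y x : (poisson_integrand a u0 y x) \_ `]0, +oo[ =
  (fun t => pkern `|a| y x t * v t) \_ K.
Proof.
apply/funext => t; rewrite !patchE; case: ifPn => [|nI]; case: ifPn => [Kt|nK] //.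
- by rewrite inE /= in_itv /= andbT => t0; rewrite poisson_integrandE.
- rewrite inE /= in_itv /= andbT => t0; rewrite poisson_integrandE // (@tsupport_out _ u0) ?mulr0 //.
  by move=> /mem_set Kt; rewrite Kt in nK.
- have t0 := K0 (set_mem Kt); case/negP: nI; by rewrite inE /= in_itv /= andbT.
Qed.

Lemma poisson_integralE y x : poisson_integral a u0 y x = kint `|a| v K pkern y x.
Proof. by rewrite /poisson_integral Rintegral_mkcond restrictE -Rintegral_mkcond. Qed.

(** Either the distance is positive on the whole support, and the integrand is continuous there, or
    it vanishes at some point of the support; this forces [sin y = 0], and the integrand is
    identically zero. *)
Lemma integrable_poisson_integrand y x :
  lebesgue_measure.-integrable `]0, +oo[ (EFin \o poisson_integrand a u0 y x).
Proof.
have [q0|] := pselect (forall t, K t -> 0 < sqdist y x t); last first.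
  move=> /existsNP[t /not_implyP[/K0 t0 /negP]]; rewrite -leNgt => q0.
  (* The sum of squares is taken with [x] and [t] exchanged, because [t > 0] is known while [x] is
     arbitrary. *)
  have s0 : sin y = 0.
    have : (t * sin y) ^+ 2 <= 0.
      apply: le_trans q0; rewrite (_ : sqdist y x t = (x - t * cos y) ^+ 2 + (t * sin y) ^+ 2).
        by rewrite lerDr sqr_ge0.
      by rewrite /sqdist [(t * sin y) ^+ 2]exprMn sin2cos2; ring.
    by rewrite exprn_even_le0 //= mulf_eq0 gt_eqF //= => /eqP.
  rewrite (_ : EFin \o _ = cst 0%E); first exact: integrable0.
  by apply/funext => t'; rewrite /= /poisson_integrand /poisson_kernel s0 !(mulr0, mul0r).
rewrite integrable_mkcond // restrict_EFin restrictE -restrict_EFin.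
rewrite -integrable_mkcond; last exact: compact_measurable.
apply: continuous_compact_integrable => //.
apply: continuous_in_subspaceT => t; rewrite inE => Kt.
apply: cvgM; last exact: cv.
by apply: (@continuous_pkern R R `|a| (cst y) (cst x) id t _ _ _ a0 (q0 t Kt));
  [exact: cvg_cst|exact: cvg_cst|exact: cvg_id].
Qed.

Lemma poisson_integral_pde y x : regular_domain u0 (y, x) ->
  [/\ twice_derivable (poisson_integral a u0 ^~ x) y,
      twice_derivable (poisson_integral a u0 y) x &
      Lop a (poisson_integral a u0 y) x = - derive1n 2 (poisson_integral a u0 ^~ x) y].
Proof.
case=> /= y0 x0 hd.
(* The square root of a nonpositive number is 0, so a nonzero [pdist] already gives a positive
   [sqdist]. *)
have q0 t : K t -> 0 < sqdist y x t.
  move=> /hd; rewrite pdistE -sqrtr_gt0 => h.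
  by rewrite lt_neqAle eq_sym h sqrtr_ge0.
have -> : poisson_integral a u0 = kint `|a| v K pkern.
  by apply/funext => ?; apply/funext => ?; exact: poisson_integralE.
have [ty dy] := twice_derivable_of_is_derive (open_Uy cK (x := x)) q0
  (is_derive_kint_y a0 cv cK (x := x)) (is_derive_kint_yy a0 cv cK q0).
have [tx dx] := twice_derivable_of_is_derive (open_Ux cK (y := y)) q0
  (is_derive_kint_x a0 cv cK (y := y)) (is_derive_kint_xx a0 cv cK q0).
split; [exact: ty|exact: tx|].
have h := is_derive_kint_x a0 cv cK q0.
apply: etrans (esym (congr1 -%R dy)).
rewrite /Lop dx derive1E (@derive_val _ _ _ _ _ _ _ h) -(kint_pde a0 cv cK q0).
by rewrite real_normK // num_real.
Qed.

End solution.

(** * The boundary value *)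

(** A limit from the right is tested on the sequences that tend to [p] from above, to which the
    dominated convergence theorem applies. *)
Lemma dominated_cvg_at_right (R : realType) (f : R -> R -> R) (l G : R -> R) (p : R) :
  (\forall y \near p^'+, continuous (f y) /\ forall s, `|f y s| <= G s) ->
  continuous l -> lebesgue_measure.-integrable setT (EFin \o G) ->
  (forall s, f y s @[y --> p^'+] --> l s) ->
  \int[lebesgue_measure]_s f y s @[y --> p^'+] --> \int[lebesgue_measure]_s l s.
Proof.
move=> nf cl iG fl; apply/cvg_at_rightP => u [up ucvg].
have ur : u n @[n --> \oo] --> p^'+.
  move=> A [e /= e0 eA]; have /cvgrPdist_lt/(_ _ e0) := ucvg.
  by apply: filterS => n un; apply: eA.
(* The domination holds only close to [p], hence from some rank [N] on; the first [N] terms are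
   dropped by a shift. *)
have [N _ hN] : \forall n \near \oo, continuous (f (u n)) /\ forall s, `|f (u n) s| <= G s.
  exact: ur nf.
rewrite -(cvg_shiftn N); apply: fine_cvg.
have hu n := hN (n + N)%N (leq_addl n N).
have [|||||il _ dc] := @dominated_convergence _ _ _ lebesgue_measure _ measurableT
  (fun n s => (f (u (n + N)%N) s)%:E) (fun s => (l s)%:E) (fun s => (G s)%:E).
- move=> n; apply/measurable_EFinP; apply: continuous_measurable_fun; exact: (hu n).1.
- apply/measurable_EFinP; exact: continuous_measurable_fun.
- apply: aeW => s _; apply: cvg_EFin; first exact: nearW.
  have h : f (u n) s @[n --> \oo] --> l s by exact: cvg_comp ur (fl s).
  by rewrite -(cvg_shiftn N) in h.
- exact: iG.
- by apply: aeW => s n _; rewrite lee_fin; exact: (hu n).2.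
by rewrite /Rintegral fineK ?integrable_fin_num.
Qed.

Lemma integralT_oneDsqrV (R : realType) :
  (\int[lebesgue_measure]_s ((oneDsqr s)^-1 : R)%:E = pi%:E)%E.
Proof.
rewrite (@ge0_symfun_integralT _ (fun s => (oneDsqr s)^-1)).
- rewrite -set_itvcy integral0y_oneDsqr -EFinM; congr EFin; by field.
- by move=> s; rewrite invr_ge0; exact: le_trans ler01 (oneDsqr_ge1 s).
- exact: continuous_oneDsqrV.
- by move=> s; rewrite /= /oneDsqr sqrrN.
Qed.

Lemma integrable_oneDsqrV (R : realType) :
  lebesgue_measure.-integrable setT (EFin \o (fun s : R => (oneDsqr s)^-1)).
Proof.
apply/integrableP; split.
  apply/measurable_EFinP; apply: continuous_measurable_fun; exact: continuous_oneDsqrV.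
under eq_integral => s _.
  rewrite gee0_abs; last by rewrite lee_fin invr_ge0; exact: le_trans ler01 (oneDsqr_ge1 s).
  over.
by rewrite integralT_oneDsqrV ltry.
Qed.

(** Since [g] vanishes outside [[- M, M]], both integrals reduce to compact intervals, with [A] and
    [B] the preimages of [- M] and [M]; there substitution along an increasing function applies. *)
Lemma Rintegral_affine_substitution (R : realType) (g : R -> R) (M c e : R) :
  0 < e -> continuous g -> (forall t, M < `|t| -> g t = 0) ->
  \int[lebesgue_measure]_t g t = \int[lebesgue_measure]_s (e * g (c + e * s)).
Proof.
move=> e0 cg g0.
(* Nonnegativity of [M] ensures [A <= B]. *)
wlog M0 : M g0 / 0 <= M.
  by move=> /(_ `|M|); apply=> // t h; apply: g0; exact: le_lt_trans (ler_norm _) h.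
pose F s := c + e * s.
pose A := (- M - c) / e; pose B := (M - c) / e.
have FA : F A = - M by rewrite /F /A; field; exact: lt0r_neq0.
have FB : F B = M by rewrite /F /B; field; exact: lt0r_neq0.
have dF (s : R) : is_derive s 1 F e.
  by rewrite /F; apply: is_derive_eq; rewrite /GRing.scale /=; ring.
have F' : derive1 F = cst e.
  by apply/funext => s; rewrite derive1E; exact: (@derive_val _ _ _ _ _ _ _ (dF s)).
have cF : continuous F by move=> s; exact: is_derive_continuous (dF s).
have AB : A <= B by rewrite ler_pM2r ?invr_gt0 //; lra.
have restr (h : R -> R) (m k : R) : (forall t, ~ m <= t <= k -> h t = 0) ->
    \int[lebesgue_measure]_t h t = \int[lebesgue_measure]_(t in `[m, k]) h t.
  move=> h0; rewrite [RHS]Rintegral_mkcond; apply: eq_Rintegral => t _.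
  rewrite patchE; case: ifPn => // /negP nI; apply: h0 => hI; apply: nI.
  by rewrite inE /= in_itv.
rewrite (restr g (- M) M); last first.
  move=> t nt; apply: g0; rewrite ltNge; apply/negP; rewrite ler_norml; exact: nt.
rewrite (restr _ A B); last first.
  move=> s ns; rewrite g0 ?mulr0 // ltNge; apply/negP; rewrite ler_norml => /andP[h1 h2].
  apply: ns; rewrite /A /B ler_pdivrMr // ler_pdivlMr //; apply/andP; split; lra.
rewrite /Rintegral -FA -{1}FB (@integration_by_substitution_increasing _ F g A B) //.
- by congr fine; apply: eq_integral => s _; rewrite F' /= mulrC.
- by move=> s t _ _ st; rewrite /F ltrD2l ltr_pM2l.
- by rewrite F' => s _; exact: cvg_cst.
- by rewrite F'; exact: is_cvg_cst.
- by rewrite F'; exact: is_cvg_cst.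
- split; first by move=> s _; exact: (@ex_derive _ _ _ _ _ _ _ (dF s)).
    by apply: cvg_at_right_filter; exact: cF.
  by apply: cvg_at_left_filter; exact: cF.
- exact: continuous_subspaceT.
Qed.

Lemma bounded_test_function (R : realType) (f : R -> R) : test_function f ->
  exists2 M : R, 0 <= M & forall t, `|f t| <= M.
Proof.
move=> hf; have cf := continuous_test_function hf; case: hf => _ cK _.
have [N [_ hN]] : bounded_set (f @` tsupport f).
  by apply: compact_bounded; apply: continuous_compact => //; exact: continuous_subspaceT.
exists (`|N| + 1) => // t.
have [Kt|nK] := pselect (tsupport f t).
  by apply: (hN (`|N| + 1)); [rewrite (le_lt_trans (ler_norm N)) // ltrDl|exists t].
by rewrite (@tsupport_out _ f) ?normr0.
Qed.

Lemma bounded_tsupport (R : realType) (f : R -> R) : test_function f ->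
  exists M : R, forall t, M < `|t| -> f t = 0.
Proof.
case=> _ cK _; have [N [_ hN]] := compact_bounded cK.
exists (`|N| + 1) => t; rewrite ltNge => /negP nt.
apply: tsupport_out => Kt; apply: nt.
by apply: (hN (`|N| + 1)) Kt; rewrite (le_lt_trans (ler_norm N)) // ltrDl.
Qed.

Section initial.
Context {R : realType} (a : R) (u0 : R -> R).
Hypotheses (ha : a != 0) (hu0 : test_function u0).

Let a0 : 0 < `|a|. Proof. by rewrite normr_gt0. Qed.
Let cu0 : continuous u0. Proof. exact: continuous_test_function. Qed.

(* The half-plane Poisson kernel times [z K_1(z) u0 x'], in the variable [s] for which
   [x' = x cos y + s x sin y]. *)
Definition rescaled_integrand (x y s : R) : R :=
  let z := `|a| * (x * sin y * Num.sqrt (oneDsqr s)) in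
  z * coshexp_int 1 z * (u0 (x * cos y + x * sin y * s) / pi) / oneDsqr s.

Let oneD0 (s : R) : 0 < oneDsqr s.
Proof. exact: lt_le_trans ltr01 (oneDsqr_ge1 s). Qed.

Let sq0 (s : R) : 0 < Num.sqrt (oneDsqr s).
Proof. by rewrite sqrtr_gt0. Qed.

Let g (x y t : R) := pkern `|a| y x t * (`|a| / pi * u0 t).

(** Here [r = x sin y sqrt(1 + s^2)]. The Jacobian and the factor [x sin y] of the kernel multiply
    to [r^2 / (1 + s^2)], which turns [|a| K_1(|a| r) / r] into [z K_1(z) / (1 + s^2)] with
    [z = |a| r]. *)
Let rescaledE (x y s : R) : 0 < x * sin y ->
  x * sin y * g x y (x * cos y + x * sin y * s) = rescaled_integrand x y s.
Proof.
move=> e0; rewrite /g /pkern /helmholtz /rescaled_integrand.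
have -> : sqdist y x (x * cos y + x * sin y * s) = (x * sin y) ^+ 2 * oneDsqr s.
  by rewrite sqdistE /oneDsqr; ring.
rewrite sqrtrM ?sqr_ge0 // sqrtr_sqr (gtr0_norm e0).
have q2 : oneDsqr s = Num.sqrt (oneDsqr s) ^+ 2 by rewrite sqr_sqrtr // ltW.
move: (coshexp_int 1 _) => j; rewrite [in X in _ = _ / X]q2.
have rn := lt0r_neq0 (sq0 s); have en := lt0r_neq0 e0.
have := lt0r_neq0 (pi_gt0 R); move: (u0 _) (pi : R) => w p pn.
move: (Num.sqrt _) (x * sin y) rn en {e0 q2} => r e rn en.
by field; rewrite rn pn en.
Qed.

(** Off the axis the kernel has no singularity at any real [t], so continuity holds on the whole
    line, as the substitution requires. *)
Let continuous_g (x y : R) : 0 < x * sin y -> continuous (g x y).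
Proof.
move=> e0 t; apply: cvgM; last by apply: cvgMr; exact: cu0.
apply: (@continuous_pkern R R `|a| (cst y) (cst x) id t);
  [exact: cvg_cst|exact: cvg_cst|exact: cvg_id|exact: a0|].
by rewrite sqdistE ltr_wpDl ?sqr_ge0 // exprn_gt0.
Qed.

Lemma poisson_integral_rescaled (x y : R) : 0 < x * sin y ->
  poisson_integral a u0 y x = \int[lebesgue_measure]_s rescaled_integrand x y s.
Proof.
move=> e0; rewrite poisson_integralE // /kint Rintegral_mkcond.
transitivity (\int[lebesgue_measure]_t g x y t).
  apply: eq_Rintegral => t _; rewrite patchE; case: ifPn => // /negP nK.
  by rewrite /g (@tsupport_out _ u0) ?mulr0 // => /mem_set.
have [M hM] := bounded_tsupport hu0.
rewrite (Rintegral_affine_substitution (M := M) (x * cos y) e0 (continuous_g e0)); last first.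
  by move=> t /hM h; rewrite /g h !mulr0.
by apply: eq_Rintegral => s _; exact: rescaledE.
Qed.

Let cvg_sin_right (x : R) : x * sin y @[y --> 0^'+] --> 0.
Proof.
rewrite -[X in _ --> X](mulr0 x); apply: cvgMr; rewrite -[X in _ --> X](@sin0 R).
by apply: cvg_at_right_filter; exact: continuous_sin.
Qed.

Let near_sin_gt0 (x : R) : 0 < x -> \forall y \near 0^'+, 0 < x * sin y.
Proof.
move=> x0; near=> y; rewrite mulr_gt0 // sin_gt0_pi //; apply/andP; split.
  by near: y; exact: nbhs_right_gt.
by near: y; apply: nbhs_right_lt; exact: pi_gt0.
Unshelve. all: by end_near. Qed.

Lemma cvg_poisson_integral (x : R) : 0 < x ->
  poisson_integral a u0 y x @[y --> 0^'+] --> u0 x.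
Proof.
move=> x0; have nx := near_sin_gt0 x0.
have [M M0 hM] := bounded_test_function hu0.
(* The pointwise limit: [z K_1(z)] tends to 1 and the argument of [u0] to [x]. Its integral is
   [u0 x] because [1 / (1 + s^2)] has integral [pi]. *)
pose l (s : R) := u0 x / pi / oneDsqr s.
have -> : u0 x = \int[lebesgue_measure]_s l s.
  rewrite RintegralZl //; last exact: integrable_oneDsqrV.
  by rewrite /Rintegral integralT_oneDsqrV /= divfK // gt_eqF // pi_gt0.
apply: cvg_trans (_ : \int[lebesgue_measure]_s rescaled_integrand x y s @[y --> 0^'+] --> _).
  apply: near_eq_cvg; apply: filterS nx => y e0; symmetry.
  exact: poisson_integral_rescaled.
(* The majorant combines [z K_1(z) <= 1] with [|u0| <= M]. *)
apply: (@dominated_cvg_at_right _ _ _ (fun s => M / pi / oneDsqr s)).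
- apply: filterS nx => y e0; split.
    (* Continuity in [s] is inherited from [g] through the affine change of variable. *)
    rewrite (_ : rescaled_integrand x y =
      fun s => x * sin y * g x y (x * cos y + x * sin y * s)); last first.
      by apply/funext => s; rewrite rescaledE.
    move=> s; apply: cvgMr.
    apply: (@cvg_comp _ _ _ (fun s => x * cos y + x * sin y * s) (g x y)); last first.
      exact: continuous_g.
    by apply: cvgD; [exact: cvg_cst|apply: cvgMr; exact: cvg_id].
  move=> s; rewrite /rescaled_integrand.
  have z0 : 0 < `|a| * (x * sin y * Num.sqrt (oneDsqr s)) := mulr_gt0 a0 (mulr_gt0 e0 (sq0 s)).
  set z := _ * (_ * _) in z0 *.
  have /andP[z1 z2] := coshexp_int1_bounds z0.
  have z3 : 0 <= z * coshexp_int 1 z := le_trans (expR_ge0 _) z1.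
  rewrite (_ : _ / oneDsqr s = (z * coshexp_int 1 z) *
    (u0 (x * cos y + x * sin y * s) * (pi^-1 / oneDsqr s))); last by rewrite !mulrA.
  rewrite -[leRHS]mulrA normrM (ger0_norm z3).
  apply: le_trans (ler_piMl (normr_ge0 _) z2) _.
  rewrite normrM (ger0_norm (_ : 0 <= pi^-1 / oneDsqr s)); last first.
    by rewrite divr_ge0 ?invr_ge0 ?pi_ge0 // ltW.
  by rewrite ler_wpM2r // divr_ge0 ?invr_ge0 ?pi_ge0 // ltW.
- move=> s; apply: cvgMr; exact: continuous_oneDsqrV.
- by apply: (integrableZl _ (M / pi) (integrable_oneDsqrV R)).
- move=> s; apply: cvgMl.
  rewrite -[X in _ --> X]mul1r; apply: cvgM.
    apply: (@cvg_comp _ _ _ (fun y => `|a| * (x * sin y * Num.sqrt (oneDsqr s)))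
      (fun z => z * coshexp_int 1 z) _ (0^'+)); last exact: cvg_mul_coshexp_int1.
    have h : `|a| * (x * sin y * Num.sqrt (oneDsqr s)) @[y --> 0^'+] --> 0.
      rewrite -[X in _ --> X](mulr0 `|a|) -[X in _ * X](mul0r (Num.sqrt (oneDsqr s))).
      by apply: cvgMr; apply: cvgMl; exact: cvg_sin_right.
    (* The limit of [z K_1(z)] is one-sided, so [z] must tend to 0 through positive values; [nx]
       supplies the sign of [x sin y]. *)
    move=> A [e /= e0 eA]; have /cvgrPdist_lt/(_ _ e0) := h.
    apply: filterS2 nx => y xy hy; apply: eA => //=.
    exact: mulr_gt0 a0 (mulr_gt0 xy (sq0 s)).
  apply: cvgMl.
  apply: (@cvg_comp _ _ _ (fun y => x * cos y + x * sin y * s) u0 _ (nbhs x)); last first.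
    exact: cu0.
  have h : x * cos y + x * sin y * s @[y --> 0^'+] --> x * 1 + 0 * s.
    apply: cvgD; last by apply: cvgMl; exact: cvg_sin_right.
    apply: cvgMr; rewrite -[X in _ --> X](@cos0 R).
    by apply: cvg_at_right_filter; exact: continuous_cos.
  by rewrite mul0r addr0 mulr1 in h.
Qed.

End initial.

Unset Implicit Arguments.

Theorem theorem2p1 (R : realType) (a : R) (ha : a != 0)
    (u0 : R -> R) (hu0 : test_function u0) :
  (forall y x : R, 0 < y -> 0 < x ->
     lebesgue_measure.-integrable `]0, +oo[
       (EFin \o poisson_integrand a u0 y x)) /\
  poisson_solution a (regular_domain u0) u0 (poisson_integral a u0).
Proof.
split; first by move=> y x _ _; exact: integrable_poisson_integrand.
split=> [y x|x]; first exact: poisson_integral_pde.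
exact: cvg_poisson_integral.
Qed.
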